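(* For any integer $a \ge 2$ and every positive integer $m$, $$\sqrt{2m}-\frac{1}{2} \le f(m,a\text{-union free}) \le 4a+ 4a^{1/4}\sqrt{m}.$$
   Context: A family $\mathcal{F}$ of sets is $a$-union free if there are no distinct sets $F_1,F_2,\dots,F_{a+1}\in\mathcal{F}$ satisfying $F_1\cup F_2\cup\dots\cup F_a=F_{a+1}$. For a property $\Gamma$ of families of sets and a family $\mathcal{F}$ of sets, $f(\mathcal{F},\Gamma)$ is the size of the largest subfamily $\mathcal{F}'\subseteq\mathcal{F}$ having property $\Gamma$. For a positive integer $m$, $f(m,\Gamma):=\min\{f(\mathcal{F},\Gamma): |\mathcal{F}|=m\}$, the minimum being over all families of $m$ distinct sets. *)

(* Defs.v *)
From HB Require Import structures.
From mathcomp Require Import all_boot finmap boolp classical_sets.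

Set Implicit Arguments.
Unset Strict Implicit.
Unset Printing Implicit Defensive.

Local Open Scope fset_scope.
Local Open Scope classical_set_scope.

(* A property of finite families of sets, given for every ground type [T]; the
   members of a family are arbitrary, possibly infinite, subsets of [T]. *)
Definition family_property := forall T : Type, {fset set T} -> Prop.

(* [F ord_max] plays the role of F_{a+1}; [injective F] says that the a+1 sets
   are distinct. *)
Definition union_free (a : nat) : family_property := fun T G =>
  ~ exists F : 'I_a.+1 -> set T,
      [/\ injective F,
          (forall i, F i \in G) &
          \bigcup_(i in [set i : 'I_a.+1 | (i < a)%N]) F i = F ord_max].

(* The size of a largest subfamily of [F] with property [Gamma]; it is 0 when
   no subfamily has this property. *)
Definition max_subfamily (Gamma : family_property) (T : Type)
    (F : {fset set T}) : nat :=
  \max_(G <- fpowerset F | `[< Gamma T G >]) #|` G|.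

Definition max_subfamily_value (Gamma : family_property) (m : nat) : pred nat :=
  fun n => `[< exists (T : Type) (F : {fset set T}),
                 #|` F| = m /\ max_subfamily Gamma F = n >].

Lemma max_subfamily_value_ex (Gamma : family_property) (m : nat) :
  exists n, max_subfamily_value Gamma m n.
Proof.
pose F : {fset set nat} := [fset [set i]%classic | i in iota 0 m]%fset.
exists (max_subfamily Gamma F); apply/asboolP; exists nat, F; split=> //.
rewrite card_imfset /=; last by move=> i j /seteqP[/(_ i erefl)].
by rewrite undup_id ?iota_uniq // size_iota.
Qed.

(* f(m, Gamma): the minimum over all families of m sets, on any ground type. *)
Definition min_max_subfamily (m : nat) (Gamma : family_property) : nat :=
  ex_minn (max_subfamily_value_ex Gamma m).

(* Main.v *)
Require Import Defs.
From HB Require Import structures.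
From mathcomp Require Import all_boot all_order all_algebra finmap.
From mathcomp Require Import all_classical all_reals all_analysis.
From mathcomp Require Import zify lra.

Set Implicit Arguments.
Unset Strict Implicit.
Unset Printing Implicit Defensive.

Import Order.TTheory GRing.Theory Num.Theory.

(** Lower bound.  If the strict subsets inside G of every member of G form a
    chain, then G is a-union free: the union of finitely many members of a chain
    is one of them.  The sets of height h (the longest chain strictly below such a
    set has h members), together with such a chain below one of them,
    form such a G, so with f = f(m, a-union free) there are at most f - h of them,
    whence 2m <= f(f+1).

    Upper bound.  Let n = floor(sqrt a), and take the sets
    {0..p} + {0..q} (disjoint union) with p, q < nk and p/k = q/k: these are n
    stacked k by k grids, a union being a coordinatewise maximum.  In an a-union
    free subfamily, no point with another point to its left in its row and
    another below it in its column has more than a points (itself included)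
    weakly below it.  So each grid contains at most 2kn points, and at most 2k
    once the lower grids contain a points, hence at most a-1+2kn+2k(n-1) points
    altogether.  Take k about sqrt(m/n). *)

(** * Finite strict orders: levels, chains and forest-like subsets *)

Section ForestLike.
Variables (P : finType) (lt : rel P).
Hypotheses (lt_irr : irreflexive lt) (lt_trans : transitive lt).

Definition comparable_rel : rel P := fun x y => [|| x == y, lt x y | lt y x].

Definition chain_below (x : P) (C : {set P}) :=
  [forall y in C, lt y x] && [forall y in C, forall z in C, comparable_rel y z].

Definition forest_like (G : {set P}) :=
  forall y u v : P, y \in G -> u \in G -> v \in G -> lt u y -> lt v y ->
  comparable_rel u v.

Definition height (x : P) : nat := \max_(C : {set P} | chain_below x C) #|C|.

Lemma height_chain x : exists2 C, chain_below x C & #|C| = height x.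
Proof.
have h0 : chain_below x finset.set0.
  by apply/andP; split; apply/forallP => y; rewrite finset.in_set0.
have : (0 < #|chain_below x|)%N by apply/card_gt0P; exists finset.set0.
by move/(eq_bigmax_cond (fun C : {set P} => #|C|)) => [C hC hE]; exists C; rewrite -?hE.
Qed.

(** Adding [x] to a longest chain below [x] gives a chain below [y]. *)
Lemma height_lt x y : lt x y -> (height x < height y)%N.
Proof.
move=> xy; have [C /andP[/forall_inP Cx /forall_inP CC] <-] := height_chain x.
have xC : x \notin C by apply/negP => /Cx; rewrite lt_irr.
have -> : #|C|.+1 = #|(x |: C)%SET| by rewrite cardsU1 xC.
apply: (@leq_bigmax_cond _ (chain_below y) (fun C : {set P} => #|C|)); apply/andP; split.
  apply/forall_inP => z; rewrite !inE => /orP[/eqP->//|/Cx zx].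
  exact: lt_trans xy.
apply/forall_inP => z; rewrite !inE => hz; apply/forall_inP => w; rewrite !inE.
case/orP: hz => [/eqP->|zC]; case/orP => [/eqP->|wC]; rewrite /comparable_rel.
- by rewrite eqxx.
- by rewrite (Cx _ wC) !orbT.
- by rewrite (Cx _ zC) !orbT.
- by have /forall_inP := CC _ zC; apply.
Qed.

(** Take the level of [x] together with a longest chain below [x]; the two are disjoint since
    heights in the chain are smaller. No member of the level lies below a member of this union, so
    whatever does lies in the chain, and the union is forest-like. *)
Lemma level_card f :
  (forall G : {set P}, forest_like G -> (#|G| <= f)%N) ->
  forall x, (#|[set y | height y == height x]%SET| + height x <= f)%N.
Proof.
move=> hf x; pose L := [set y | height y == height x]%SET.
rewrite -/L.
have [C /andP[/forall_inP Cx /forall_inP CC] hC] := height_chain x.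
have LC : L :&: C = finset.set0.
  apply/finset.setP => y; rewrite !inE; apply/negP => /andP[/eqP e /Cx /height_lt].
  by rewrite e ltnn.
have := hf (L :|: C)%SET; rewrite cardsU LC cards0 subn0 hC; apply.
have below y u : y \in (L :|: C)%SET -> u \in (L :|: C)%SET -> lt u y -> u \in C.
  rewrite !inE => hy /orP[/eqP hu|//] /height_lt; rewrite hu.
  by case/orP: hy => [/eqP->|/Cx /height_lt /ltn_trans h /h]; rewrite ltnn.
move=> y u v yG uG vG uy vy.
by have /forall_inP := CC _ (below _ _ yG uG uy); apply; exact: (below y).
Qed.

Lemma card_le_triangular f :
  (forall G : {set P}, forest_like G -> (#|G| <= f)%N) ->
  (2 * #|P| <= f * f.+1)%N.
Proof.
move=> hf; have lev := level_card hf.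
have hlt x : (height x < f)%N.
  have := lev x; rewrite addnC; apply: leq_trans; rewrite -addn1 leq_add2l.
  by apply/card_gt0P; exists x; rewrite inE.
have -> : #|P| = \sum_(h < f) #|[set y | height y == h]%SET|.
  rewrite -sum1_card (partition_big (fun x => Ordinal (hlt x)) predT) //=.
  apply: eq_bigr => h _; rewrite -sum1_card; apply: eq_bigl => x.
  by rewrite !inE.
have tri : (2 * \sum_(h < f) (f - h) = f * f.+1)%N.
  elim: (f) => [|g IH]; first by rewrite big_ord0.
  rewrite big_ord_recl subn0 mulnDr (eq_bigr (fun h : 'I_g => g - h))%N => [|h _].
    by rewrite IH; lia.
  by rewrite lift0 subSS.
rewrite -tri leq_mul2l /=; apply: leq_sum => h _.
(* [level_card] speaks of the level of a given element, so empty levels are treated apart. *)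
have [/card_gt0P[x]|] := ltnP 0 #|[set y | height y == h]%SET|.
  by rewrite inE => /eqP e; have := lev x; rewrite e; lia.
by lia.
Qed.

End ForestLike.

(** * Subsets of a grid with few points below a corner *)

Section Grid.
Variable N : nat.
Implicit Types (S A : {set 'I_N * 'I_N}) (p q : 'I_N * 'I_N).

(** Here [f] names the line of an element and [g] its position on that line. An element is
    determined by its line and its rank there, and only [x] ranks are allowed. Serves both rows and
    columns. *)
Lemma card_small_rank (I : finType) (A : {set I}) (f g : I -> 'I_N) (x : nat) :
  injective (fun i => (f i, g i)) ->
  (#|[set i in A | #|[set j in A | f j == f i & (g j < g i)%N]| < x]|
     <= x * #|[set f i | i in A]|)%SET%N.
Proof.
move=> inj; pose r i := #|[set j in A | (f j == f i) && (g j < g i)%N]%SET|.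
pose B := [set i in A | (r i < x)%N]%SET; rewrite -/B.
have rB i : i \in B -> (r i < x)%N by rewrite inE => /andP[].
have x0 i : i \in B -> (0 < x)%N by move/rB; exact: leq_trans.
have [->|[i0 /x0]] := set_0Vmem B; first by rewrite cards0.
case: x @B rB {x0} => [//|x] B rB _.
pose F i := (f i, inord (r i) : 'I_x.+1).
have rlt i j : i \in A -> f i = f j -> (g i < g j)%N -> (r i < r j)%N.
  move=> iA fij gij; apply: proper_card; apply/properP; split.
    apply/fintype.subsetP => l; rewrite !inE fij => /and3P[-> -> /= h].
    exact: ltn_trans gij.
  by exists i; rewrite !inE iA ?fij ?eqxx ?gij ?ltnn ?andbF.
have Finj : {in B &, injective F}.
  move=> i j iB jB [fij /(congr1 val)]; rewrite /= !inordK ?rB // => rij.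
  have iA : i \in A by move: iB; rewrite inE => /andP[].
  have jA : j \in A by move: jB; rewrite inE => /andP[].
  apply: inj; congr pair => //; apply: val_inj => /=.
  case: (ltngtP (g i) (g j)) => // h.
    by have := rlt _ _ iA fij h; rewrite rij ltnn.
  by have := rlt _ _ jA (esym fij) h; rewrite rij ltnn.
rewrite -(card_in_imset Finj).
apply: (@leq_trans #|finset.setX [set f i | i in A]%SET [set: 'I_x.+1]%SET|); last first.
  by rewrite cardsX cardsT card_ord mulnC.
apply: subset_leq_card; apply/fintype.subsetP => _ /imsetP[i iB ->].
rewrite !inE /= andbT; apply: imset_f; by move: iB; rewrite inE => /andP[].
Qed.

Definition below p q := (q.1 <= p.1)%N && (q.2 <= p.2)%N.

(* Discard the [x] leftmost points of each row, then the [y] lowest remaining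
   points of each column: any survivor has [y] points below it in its column
   which, like itself, have [x] points to their left. *)
Lemma dense_grid_point S (x y : nat) :
  (0 < x)%N -> (0 < y)%N ->
  (x * #|[set p.1 | p in S]%SET| + y * #|[set p.2 | p in S]%SET| < #|S|)%N ->
  exists p, [/\ p \in S,
    exists2 u, u \in S & u.1 = p.1 /\ (u.2 < p.2)%N,
    exists2 v, v \in S & v.2 = p.2 /\ (v.1 < p.1)%N &
    (x.+1 * y.+1 <= #|[set q in S | below p q]%SET|)%N].
Proof.
move=> x0 y0 hS.
pose row A p := [set q in A | (q.1 == p.1) && (q.2 < p.2)%N]%SET.
pose col A p := [set q in A | (q.2 == p.2) && (q.1 < p.1)%N]%SET.
pose T := [set p in S | (x <= #|row S p|)%N]%SET.
have TS : T \subset S by apply/fintype.subsetP => q; rewrite inE => /andP[].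
have h1 : (#|S :\: T| <= x * #|[set p.1 | p in S]%SET|)%N.
  have inj : injective (fun p : 'I_N * 'I_N => (p.1, p.2)) by move=> [? ?] [? ?] [-> ->].
  apply: leq_trans (card_small_rank S x inj); apply: subset_leq_card.
  apply/fintype.subsetP => p; rewrite !inE => /andP[h pS].
  by move: h; rewrite pS /= -ltnNge.
have h2 : (#|[set p in T | (#|col T p| < y)%N]%SET| <= y * #|[set p.2 | p in S]%SET|)%N.
  have inj : injective (fun p : 'I_N * 'I_N => (p.2, p.1)) by move=> [? ?] [? ?] [-> ->].
  apply: leq_trans (card_small_rank T y inj) _.
  by rewrite leq_mul2l subset_leq_card ?orbT // imsetS.
have : exists2 p, p \in T & (y <= #|col T p|)%N.
  apply: contrapT => none.
  move: hS; rewrite -(cardsID T S) (finset.setIidPr TS) ltnNge => /negP; apply.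
  rewrite addnC leq_add //; apply: leq_trans h2; apply: subset_leq_card.
  apply/fintype.subsetP => p pT; rewrite inE pT /= ltnNge.
  by apply/negP => hp; apply: none; exists p.
case=> p pT hp; exists p.
have pS := fintype.subsetP TS _ pT.
have xr q : q \in T -> (x <= #|row S q|)%N by rewrite inE => /andP[].
split=> //.
- have /card_gt0P[u] : (0 < #|row S p|)%N by apply: leq_trans x0 (xr _ pT).
  by rewrite inE => /and3P[uS /eqP e l]; exists u.
- have /card_gt0P[v] : (0 < #|col T p|)%N by apply: leq_trans y0 hp.
  by rewrite inE => /and3P[/(fintype.subsetP TS) vS /eqP e l]; exists v.
(* At least [y.+1] points in the column of [p], all surviving the first deletion. They lie in
   distinct rows, and each accounts for itself and [x] points to its left. *)
pose K := (p |: col T p)%SET.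
have KP q : q \in K -> [/\ q \in T, q.2 = p.2 & (q.1 <= p.1)%N].
  by case/setU1P => [->//|]; rewrite [q \in col _ _]inE => /and3P[? /eqP-> /ltnW].
have Kcard : (y < #|K|)%N.
  by rewrite cardsU1 inE ltnn !andbF add1n ltnS hp.
have Kinj : {in K &, injective fst}.
  move=> [i j] [i' j'] /KP[_ /= -> _] /KP[_ /= -> _] /= -> //.
rewrite -sum1_card (partition_big fst predT) //=.
apply: (@leq_trans (\sum_(i in (fst @: K)%SET) x.+1)).
  by rewrite sum_nat_const card_in_imset // mulnC leq_mul2r Kcard orbT.
rewrite big_mkcond /=; apply: leq_sum => i _; case: ifP => // /imsetP[q qK ->].
have [qT q2 q1] := KP _ qK.
have qS := fintype.subsetP TS _ qT.
rewrite sum1_card; apply: (@leq_trans #|(q |: row S q)%SET|).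
  by rewrite cardsU1 inE ltnn !andbF add1n ltnS xr.
apply: subset_leq_card; apply/fintype.subsetP => u.
move=> hu; rewrite unfold_in inE /below -q2.
case/setU1P: hu => [->|]; first by rewrite qS q1 eqxx leqnn.
by rewrite inE => /and3P[-> /eqP-> /ltnW->]; rewrite q1 eqxx.
Qed.


Definition row_col_free (a : nat) S := forall p u v,
  p \in S -> u \in S -> v \in S ->
  u.1 = p.1 -> (u.2 < p.2)%N -> v.2 = p.2 -> (v.1 < p.1)%N ->
  (#|[set q in S | below p q]%SET| <= a)%N.

Variables (k n t a : nat) (S : {set 'I_N * 'I_N}).
Hypotheses (k_gt0 : (0 < k)%N) (n_gt0 : (0 < n)%N) (Nk : N = (t * k)%N).
Hypotheses (a_gt0 : (0 < a)%N) (an : (a < n.+1 * n.+1)%N).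
Hypothesis S_diag : forall p, p \in S -> (p.1 %/ k = p.2 %/ k)%N.
Hypothesis S_free : row_col_free a S.

Let block s := [set p in S | p.1 %/ k == s]%SET.
Let lower s := [set p in S | p.1 %/ k < s]%SET.

Lemma card_block s : (#|[set i : 'I_N | i %/ k == s]%SET| <= k)%N.
Proof using k_gt0.
pose g (i : 'I_N) := Ordinal (ltn_pmod i k_gt0).
have ginj : {in [set i : 'I_N | i %/ k == s]%SET &, injective g}.
  move=> i j; rewrite !inE => /eqP si /eqP sj [e]; apply: val_inj => /=.
  by rewrite (divn_eq i k) (divn_eq j k) si sj e.
by rewrite -(card_in_imset ginj) -[leqRHS](card_ord k) max_card.
Qed.

(** A block meets at most [k] rows and [k] columns, so a larger one would contain a point [p] as in
    [dense_grid_point]. All points of the lower blocks are below [p] as well, which makes more than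
    [a] points below [p]. *)
Lemma block_bound s (x y : nat) : (0 < x)%N -> (0 < y)%N ->
  (a < x.+1 * y.+1 + #|lower s|)%N -> (#|block s| <= k * (x + y))%N.
Proof using k_gt0 S_diag S_free.
move=> x0 y0 ha; rewrite leqNgt; apply/negP => hk.
have bS p : p \in block s -> p \in S by rewrite inE => /andP[].
have b1 p : p \in block s -> (p.1 %/ k = s)%N by rewrite inE => /andP[_ /eqP].
have [p [pb [u ub [u1 u2]] [v vb [v1 v2]] hp]] : exists p, [/\ p \in block s,
    exists2 u, u \in block s & u.1 = p.1 /\ (u.2 < p.2)%N,
    exists2 v, v \in block s & v.2 = p.2 /\ (v.1 < p.1)%N &
    (x.+1 * y.+1 <= #|[set q in block s | below p q]%SET|)%N].
  apply: dense_grid_point => //; apply: leq_ltn_trans hk.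
  rewrite mulnDr ![(k * _)%N]mulnC; apply: leq_add; rewrite leq_mul2l;
    apply/orP; right; apply: leq_trans (card_block s);
    apply: subset_leq_card; apply/fintype.subsetP => _ /imsetP[q qb ->].
  - by rewrite inE (b1 _ qb).
  - by rewrite inE -S_diag ?bS // (b1 _ qb).
have := S_free (bS _ pb) (bS _ ub) (bS _ vb) u1 u2 v1 v2.
apply/negP; rewrite -ltnNge; apply: leq_trans ha _.
apply: (@leq_trans (#|[set q in block s | below p q]%SET| + #|lower s|)).
  by rewrite leq_add2r.
rewrite -cardsUI (_ : _ :&: _ = finset.set0) ?cards0 ?addn0; last first.
  apply/finset.setP => q; rewrite !inE; apply/negP.
  by case/andP => /andP[/andP[_ /eqP ->] _] /andP[_]; rewrite ltnn.
apply: subset_leq_card; apply/fintype.subsetP => q; rewrite !inE.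
case/orP => [/andP[/andP[-> _] ->]//|/andP[qS]]; rewrite qS -(b1 _ pb) /below /=.
have lt_div i j : (i %/ k < j %/ k)%N -> (i <= j)%N.
  by rewrite !ltnNge => h; apply: ltnW; rewrite ltnNge; apply: contra h; exact: leq_div2r.
move=> h; apply/andP; split; apply: lt_div => //.
by rewrite -!S_diag // bS.
Qed.

(** Count blocks from the bottom. The block that lifts the total above [a.-1] is bounded with
    [x = y = n], each of the at most [t.-1] later ones with [x = y = 1]. *)
Lemma card_diagonal_free : (#|S| <= a.-1 + 2 * k * n + 2 * k * t.-1)%N.
Proof.
have lowS s : (#|lower s.+1| = #|lower s| + #|block s|)%N.
  rewrite -cardsUI (_ : _ :&: _ = finset.set0) ?cards0 ?addn0; last first.
    apply/finset.setP => q; rewrite !inE; apply/negP.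
    by case/andP => /andP[_ h] /andP[_ /eqP e]; rewrite e ltnn in h.
  apply: eq_card => q; rewrite !inE ltnS leq_eqVlt.
  by case: (q \in S); rewrite //= orbC.
(* In the second case one of the [s] blocks crossed the threshold, at cost [2 * k * n], and at most
   [s.-1] came after it. *)
have inv s : (#|lower s| <= a.-1)%N \/
    (0 < s)%N /\ (#|lower s| <= a.-1 + 2 * k * n + 2 * k * s.-1)%N.
  elim: s => [|s IH].
    left; rewrite (_ : lower 0 = finset.set0) ?cards0 //.
    by apply/finset.setP => q; rewrite !inE andbF.
  have [hs|hs] := leqP #|lower s.+1| a.-1; [by left|right; split=> //].
  have [la|la] := leqP #|lower s| a.-1.
    have : (#|block s| <= k * (n + n))%N by apply: block_bound => //; lia.
    rewrite lowS /=; move: #|block s| #|lower s| la {hs IH} => b l la hb.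
    by nia.
  have b2 : (#|block s| <= k * (1 + 1))%N by apply: block_bound => //; lia.
  case: IH => [/leq_ltn_trans/(_ la)|[s0 IH]]; first by rewrite ltnn.
  rewrite lowS /=; move: #|block s| #|lower s| IH b2 {la hs} => b l hl hb.
  by case: s s0 hl => // s _ /=; nia.
have -> : S = lower t.
  apply/finset.setP => q; rewrite inE ltn_divLR // -Nk ltn_ord.
  by rewrite andbT.
by have [h|[]//] := inv t; rewrite -addnA; apply: leq_trans h (leq_addr _ _).
Qed.

End Grid.

(** * Lower bound: from the order to families of sets *)

Lemma chain_union_free (T : Type) (a : nat) (G : {fset set T}) : (0 < a)%N ->
  (forall X Y Z, X \in G -> Y \in G -> Z \in G ->
     (Y `<` X -> Z `<` X -> Y `<=` Z \/ Z `<=` Y)%classic) ->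
  union_free a G.
Proof.
move=> a0 hG [F [Finj FG FU]].
pose top : 'I_a.+1 := ord_max.
have sub (i : 'I_a.+1) : (i < a)%N -> (F i `<` F top)%classic.
  move=> ia; split.
    by rewrite -FU => x Fx; exists i.
  move=> h; suff /(congr1 val)/= e : i = top by rewrite e ltnn in ia.
  by apply: Finj; apply/seteqP; split=> //; rewrite -FU => x Fx; exists i.
have chain (i j : 'I_a.+1) : (i < a)%N -> (j < a)%N ->
    (F i `<=` F j)%classic \/ (F j `<=` F i)%classic.
  by move=> ia ja; apply: (hG (F top)); rewrite ?FG //; exact: sub.
(* The first [a] sets are strict subsets of the last one, hence a chain; its largest member is found
   by induction on the number [b] of sets inspected. It contains the union, against strictness. *)
have [j ja jmax] : exists2 j : 'I_a.+1, (j < a)%N &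
    forall i : 'I_a.+1, (i < a)%N -> (F i `<=` F j)%classic.
  have : forall b, (0 < b <= a)%N -> exists2 j : 'I_a.+1, (j < a)%N &
      forall i : 'I_a.+1, (i < b)%N -> (F i `<=` F j)%classic.
    elim=> // b IH /= ba; have [b0|b0] := posnP b.
      exists ord0 => // i; rewrite b0 ltnS leqn0 => /eqP i0.
      by have -> : i = ord0 by exact: val_inj.
    have [|j ja jmax] := IH; first by rewrite b0 ltnW.
    have ba1 : (b < a.+1)%N by rewrite ltnS ltnW.
    have [h|h] := chain j (Ordinal ba1) ja ba.
      exists (Ordinal ba1) => // i; rewrite ltnS leq_eqVlt => /orP[/eqP e|ib].
        by have -> : i = Ordinal ba1 by exact: val_inj.
      exact: subset_trans (jmax _ ib) h.
    exists j => // i; rewrite ltnS leq_eqVlt => /orP[/eqP e|ib]; last exact: jmax.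
    by have -> : i = Ordinal ba1 by exact: val_inj.
  by move=> /(_ a); rewrite a0 leqnn => /(_ isT).
have [_] := sub j ja; apply; rewrite -FU => x [i /= ia Fx].
exact: jmax Fx.
Qed.

(** Apply [card_le_triangular] to strict inclusion on [F]: forest-like subfamilies are union
    free. *)
Lemma max_subfamily_lower (T : Type) (a m : nat) (F : {fset set T}) : (0 < a)%N ->
  #|` F| = m ->
  (2 * m <= max_subfamily (union_free a) F * (max_subfamily (union_free a) F).+1)%N.
Proof.
move=> a0 <-; rewrite cardfE.
pose lt : rel F := fun X Y => `[< (val X `<` val Y)%classic >].
have lt_irr : irreflexive lt.
  by move=> X; apply/negbTE/negP => /asboolP[_]; apply.
have lt_trans : transitive lt.
  move=> X Y Z /asboolP YX /asboolP XZ; apply/asboolP; split.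
    by apply: subset_trans (proj1 YX) (proj1 XZ).
  by move=> ZY; apply: (proj2 YX); apply: subset_trans (proj1 XZ) ZY.
apply: (card_le_triangular lt_irr lt_trans) => G hG.
pose H : {fset set T} := [fset val X | X in G]%fset.
have HG X : X \in H -> exists2 Y, Y \in G & X = val Y by move=> /imfsetP[Y /= ? ->]; exists Y.
have -> : #|G| = #|` H| by rewrite card_imfset //=; [rewrite -cardE | exact: val_inj].
rewrite /max_subfamily; apply: (@leq_bigmax_seq _ _ _ (fun G : {fset set T} => #|` G|)).
  rewrite fpowersetE; apply/fsubsetP => X /HG[Y _ ->]; exact: valP.
apply/asboolP; apply: chain_union_free => // _ _ _ /HG[X XG ->] /HG[Y YG ->] /HG[Z ZG ->] YX ZX.
have /or3P[/eqP->|/asboolP[? _]|/asboolP[? _]] := hG X Y Z XG YG ZG (asboolT YX) (asboolT ZX).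
- by left.
- by left.
- by right.
Qed.

(** * Upper bound: grid points as sets *)

(** The tag [false] marks the initial segment up to [p.1], the tag [true] the one up to [p.2]. *)
Definition quadrant (p : nat * nat) : set (bool * nat) :=
  [set z | (z.2 <= if z.1 then p.2 else p.1)%N]%classic.

Lemma quadrant_inj : injective quadrant.
Proof.
move=> [i j] [i' j'] /seteqP[h h'].
have := (h (false, i), h (true, j), h' (false, i'), h' (true, j')).
rewrite /quadrant /= !leqnn => -[[[/(_ isT) h1 /(_ isT) h2] /(_ isT) h3] /(_ isT) h4].
by congr pair; apply/eqP; rewrite eqn_leq ?h1 ?h2 ?h3 ?h4.
Qed.

Section Points.
Variable N : nat.

Definition point_set (p : 'I_N * 'I_N) := quadrant (val p.1, val p.2).

Lemma point_set_inj : injective point_set.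
Proof. by move=> [i j] [i' j'] /quadrant_inj [/val_inj -> /val_inj ->]. Qed.

Definition points (G : {fset set (bool * nat)}) := [set p | point_set p \in G]%SET.

(** Given more than [a] points weakly below [p], choose [a] of them other than [p], among them [u]
    and [v]. Since [u] attains the first coordinate of [p] and [v] the second, their union is the
    set of [p]. *)
Lemma points_row_col_free (a : nat) (G : {fset set (bool * nat)}) : (1 < a)%N ->
  union_free a G -> row_col_free a (points G).
Proof.
move=> a1 Gfree p u v pS uS vS u1 u2 v2 v1; rewrite leqNgt; apply/negP => hA.
apply: Gfree.
set A := [set q in points G | below p q]%SET in hA.
have pA : p \in A by rewrite inE pS /below !leqnn.
have uA : u \in A by rewrite inE uS /below u1 leqnn ltnW.
have vA : v \in A by rewrite inE vS /below v2 leqnn ltnW.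
have up : u != p by apply/eqP => e; rewrite e ltnn in u2.
have vp : v != p by apply/eqP => e; rewrite e ltnn in v1.
have uv : v != u by apply/eqP => e; rewrite e u1 ltnn in v1.
(* Listing [u] and [v] first keeps them in the truncation, as [a] is at least 2; [p] is left out to
   serve as the union. *)
pose s := take a [:: u, v & enum (A :\ p :\ u :\ v)%SET].
have s_size : size s = a.
  rewrite size_takel //= -cardE.
  have := cardsD1 v (A :\ p :\ u)%SET; have := cardsD1 u (A :\ p)%SET.
  have := cardsD1 p A; rewrite !in_setD1 pA uA vA up vp uv /=.
  by move=> e1 e2 e3; move: hA; rewrite e1 e2 e3 !add1n ltnS.
have su : u \in s by rewrite /s; case: (a) a1 => [|[|b]] //= _; rewrite !inE eqxx.
have sv : v \in s by rewrite /s; case: (a) a1 => [|[|b]] //= _; rewrite !inE eqxx orbT.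
have sA q : q \in s -> (q \in A) && (q != p).
  move=> /mem_take; rewrite !in_cons mem_enum => /or3P[/eqP->|/eqP->|]; rewrite ?uA ?vA //.
  by rewrite !in_setD1 => /and4P[_ _ -> ->].
have s_uniq : uniq (rcons s p).
  rewrite rcons_uniq; apply/andP; split; first by apply/negP => /sA; rewrite eqxx andbF.
  apply: take_uniq; rewrite /= mem_enum !inE negb_or eq_sym uv enum_uniq mem_enum !inE.
  by rewrite !eqxx /= ?andbF.
have r_size : size (rcons s p) = a.+1 by rewrite size_rcons s_size.
have rA q : q \in rcons s p -> q \in A.
  by rewrite mem_rcons in_cons => /orP[/eqP->//|/sA/andP[]].
exists (fun i : 'I_a.+1 => point_set (nth p (rcons s p) i)); split.
- move=> i j /point_set_inj/eqP; rewrite nth_uniq ?r_size // => /eqP; exact: val_inj.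
- move=> i; have /rA : nth p (rcons s p) i \in rcons s p by rewrite mem_nth ?r_size.
  by rewrite !inE => /andP[].
- rewrite /= [X in _ = point_set X]nth_rcons s_size ltnn eqxx; apply/seteqP; split.
    move=> [b z] [i /= ia]; rewrite nth_rcons s_size ia.
    have /sA : nth p s i \in s by rewrite mem_nth ?s_size.
    rewrite inE => /andP[/andP[_ /andP[h1 h2]] _] h.
    by case: b h; rewrite /point_set /quadrant /= => /leq_trans; apply.
  have ex q : q \in s -> (point_set q `<=` \bigcup_(i in [set i : 'I_a.+1 | (i < a)%N])
      point_set (nth p (rcons s p) i))%classic.
    move=> qs z hz; have iq : (index q s < a)%N by rewrite -s_size index_mem.
    exists (inord (index q s)); rewrite /= inordK ?ltnS ?(ltnW iq) //.
    by rewrite nth_rcons s_size iq nth_index.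
  move=> [[] z]; rewrite /point_set /quadrant /= => hz.
    by apply: (ex _ sv); rewrite /point_set /quadrant /= v2.
  by apply: (ex _ su); rewrite /point_set /quadrant /= u1.
Qed.

End Points.

(** A block index and two offsets below [k] give a point of the diagonal, and quotient and remainder
    recover them. *)
Lemma card_diagonal (n k : nat) : (0 < k)%N ->
  (n * k * k <= #|[set p : 'I_(n * k) * 'I_(n * k) | (p.1 %/ k == p.2 %/ k)%N]%SET|)%N.
Proof.
move=> k0.
have lt (s : 'I_n) (i : 'I_k) : (s * k + i < n * k)%N.
  have := ltn_ord s; have := ltn_ord i; nia.
pose g (x : 'I_n * 'I_k * 'I_k) := (Ordinal (lt x.1.1 x.1.2), Ordinal (lt x.1.1 x.2)).
have dv (s : nat) (i : 'I_k) : ((s * k + i) %/ k = s)%N.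
  by rewrite divnMDl // divn_small // addn0.
have md (s : nat) (i : 'I_k) : ((s * k + i) %% k = i)%N by rewrite modnMDl modn_small.
have ginj : injective g.
  move=> [[s i] j] [[s' i'] j'] [/= e1 e2].
  have es := congr1 (fun z => z %/ k)%N e1; rewrite /= !dv in es.
  have ei := congr1 (fun z => z %% k)%N e1; rewrite /= !md in ei.
  have ej := congr1 (fun z => z %% k)%N e2; rewrite /= !md in ej.
  by rewrite (val_inj es) (val_inj ei) (val_inj ej).
have <- : #|{: 'I_n * 'I_k * 'I_k}| = (n * k * k)%N by rewrite !card_prod !card_ord.
rewrite -(card_imset _ ginj); apply: subset_leq_card; apply/fintype.subsetP => _ /imsetP[x _ ->].
by rewrite inE /= !dv.
Qed.

(** Any [m] points of the diagonal blocks form a witness family; a union free subfamily is counted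
    through its points, with as many blocks as the parameter [n]. *)
Lemma min_max_subfamily_upper (a m n k : nat) :
  (1 < a)%N -> (0 < n)%N -> (0 < k)%N -> (a < n.+1 * n.+1)%N -> (m <= n * k * k)%N ->
  (min_max_subfamily m (union_free a) <= a.-1 + 2 * k * n + 2 * k * n.-1)%N.
Proof.
move=> a1 n0 k0 an mk.
pose Dg := [set p : 'I_(n * k) * 'I_(n * k) | (p.1 %/ k == p.2 %/ k)%N]%SET.
pose s := take m (enum Dg).
have s_size : size s = m by rewrite size_takel // -cardE (leq_trans mk) // card_diagonal.
pose F : {fset set (bool * nat)} := [fset @point_set (n * k) p | p in s]%fset.
have Fm : #|` F| = m.
  rewrite card_imfset /=; last exact: point_set_inj.
  by rewrite undup_id ?s_size // take_uniq // enum_uniq.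
rewrite /min_max_subfamily; case: ex_minnP => f _ /(_ (max_subfamily (union_free a) F)).
move=> /(_ _)/leq_trans; apply; first by apply/asboolP; exists (bool * nat)%type, F.
apply/bigmax_leqP_seq => G; rewrite fpowersetE => /fsubsetP GF /asboolP Gfree.
pose S := points (n * k) G.
have GE : G = [fset point_set p | p in S]%fset.
  apply/fsetP => X; apply/idP/imfsetP => [XG|[p /=]]; last by rewrite inE => ? ->.
  have /imfsetP[p /= _ e] := GF _ XG.
  by exists p => //=; rewrite inE -e.
have -> : #|` G| = #|S|.
  by rewrite GE card_imfset /=; [rewrite -cardE | exact: point_set_inj].
apply: (@card_diagonal_free (n * k) k n n a) => //; first exact: ltnW.
  move=> p; rewrite inE => /GF /imfsetP[q /= /mem_take qs /point_set_inj ->].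
  by move: qs; rewrite mem_enum inE => /eqP.
exact: points_row_col_free.
Qed.

(** * Choice of parameters and real estimates *)

Local Open Scope ring_scope.

Theorem theorem1p2 (R : realType) (a m : nat) (ha : (2 <= a)%N) (hm : (0 < m)%N) :
  Num.sqrt (2 * m%:R) - 1 / 2 <= (min_max_subfamily m (union_free a))%:R :> R /\
  (min_max_subfamily m (union_free a))%:R
    <= 4 * a%:R + 4 * (a%:R `^ (1 / 4)) * Num.sqrt m%:R :> R.
Proof.
split.
  have : (2 * m <= min_max_subfamily m (union_free a) * (min_max_subfamily m (union_free a)).+1)%N.
    rewrite /min_max_subfamily; case: ex_minnP => f /asboolP[T [F [Fm <-]]] _.
    by apply: max_subfamily_lower => //; exact: ltnW.
  set f := min_max_subfamily _ _; rewrite -(ler_nat R) !natrM -[f.+1%:R]natr1 => h.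
  (* The square of [f + 1/2] is [f * (f + 1) + 1/4], at least [2 * m]. *)
  rewrite lerBlDr -[leRHS]ger0_norm ?addr_ge0 // -sqrtr_sqr.
  by apply: ler_wsqrtr; move: h; rewrite expr2; lra.
have [n [n0 na an]] : exists n, [/\ (0 < n)%N, (n * n <= a)%N & (a < n.+1 * n.+1)%N].
  have ex : exists n, (n * n <= a)%N by exists 0%N.
  have bd i : (i * i <= a)%N -> (i <= a)%N by nia.
  have [n hn hmax] := ex_maxnP ex bd; exists n; split=> //.
    by apply: hmax; apply: ltnW.
  by rewrite ltnNge; apply/negP => /hmax; rewrite ltnn.
(* Blocks of side [k.+1] have room for [m] points, while [k], the floor of the square root of
   [m / n], enters the final estimate. *)
have [k [hk km]] : exists k, (m <= n * k.+1 * k.+1)%N /\ (n * k * k <= m)%N.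
  have ex : exists k, (n * k * k <= m)%N by exists 0%N; rewrite !muln0.
  have bd i : (n * i * i <= m)%N -> (i <= m)%N by nia.
  have [k hk hmax] := ex_maxnP ex bd; exists k; split=> //.
  by apply: ltnW; rewrite ltnNge; apply/negP => /hmax; rewrite ltnn.
have := min_max_subfamily_upper ha n0 (ltn0Sn k) an hk.
set f := min_max_subfamily _ _; move=> hf.
(* The bound equals [a + 4n + 4nk - 2k - 3], and [4n - 3 <= 3n^2 <= 3a]. *)
have {}hf : (f <= 4 * a + 4 * (n * k))%N.
  by apply: leq_trans hf _; nia.
rewrite -(ler_nat R) natrD !natrM in hf; apply: le_trans hf _.
rewrite lerD2l -mulrA ler_wpM2l //.
pose r : R := a%:R `^ (1 / 4).
have r0 : 0 <= r by exact: powR_ge0.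
have r4 : r ^+ 4 = a%:R.
  rewrite -powR_mulrn // -powRrM; rewrite (_ : 1 / 4 * 4%:R = 1) ?powRr1 //.
  by rewrite mul1r mulVf.
have nr : n%:R <= r ^+ 2.
  rewrite -(@ler_pXn2r _ 2) ?nnegrE ?exprn_ge0 // -exprM r4.
  by rewrite -natrX ler_nat expnS expn1.
rewrite -(@ler_pXn2r _ 2) ?nnegrE ?mulr_ge0 ?sqrtr_ge0 //.
rewrite exprMn [leRHS]exprMn sqr_sqrtr //.
have : n%:R * k%:R * k%:R <= m%:R :> R by rewrite -!natrM ler_nat.
(* Split the square of [n * k] as [n] times [n * k^2], bounded by [r^2] and [m]. *)
move=> h; rewrite expr2 -mulrA; apply: ler_pM => //.
by rewrite expr2 mulrA.
Qed.
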